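(* Let $\mathbf{A}$ be an indexing collection on $T$, let $\sigma\in M(\mathbf{A})$, and let $X=\{X_A:A\in\mathbf{A}\}$ be a set-indexed Brownian motion with variance $\sigma$. Then, for all sequences $\{A_n\}$ in $\mathbf{A}$ with $A_n\uparrow T$ (lower and upper limits as $A\uparrow T$ being taken along $A=A_n$, $n\to\infty$): (a) $\varliminf_{A\uparrow T}\dfrac{X_A}{\sigma_A}=0$ for almost all $\omega$; (b) $P\left[\varliminf_{A\uparrow T}X_A=-\infty\right]=P\left[\varlimsup_{A\uparrow T}X_A=\infty\right]=1$.
   Context: Let $(T,\tau)$ be a nonvoid $\sigma$-compact connected topological space with Borel $\sigma$-algebra $\mathbf{B}$. A nonempty class $\mathbf{A}$ of compact connected subsets of $T$ is an indexing collection if: (1) $\varnothing\in\mathbf{A}$ and there is an increasing sequence $(B_n)$ in $\mathbf{A}$ with $T=\bigcup_n B_n^\circ$; (2) $\mathbf{A}$ is closed under arbitrary intersections, $A\cap B\neq\varnothing$ for nonempty $A,B\in\mathbf{A}$, and if $(A_i)$ is an increasing sequence in $\mathbf{A}$ with all $A_i\subseteq B_n$ for some $n$, then $\overline{\bigcup_i A_i}\in\mathbf{A}$; (3) $\sigma(\mathbf{A})=\mathbf{B}$. Let $\varnothing'$ be the intersection of all nonempty sets of $\mathbf{A}$. $\mathbf{A}(\mathbf{u})$ is the class of finite unions of sets in $\mathbf{A}$; $\mathbf{C}$ is the class of sets $A\setminus B$ with $A\in\mathbf{A}$, $B\in\mathbf{A}(\mathbf{u})$; $\mathbf{C}(\mathbf{u})$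 is the class of finite unions of sets in $\mathbf{C}$. $M(\mathbf{A})$: positive measures $\sigma$ on $(T,\mathbf{B})$ with $\sigma_{\varnothing'}=0$ and $\sigma_A<\sigma_B$ for all nonempty $A,B\in\mathbf{A}$ with $A\subsetneq B$ (notation $\sigma_A=\sigma(A)$). $X$ is a set-indexed Brownian motion with variance $\sigma$ if it extends to an (a.s.) finitely additive process on $\mathbf{C}(\mathbf{u})$ and for disjoint $C_1,\dots,C_n\in\mathbf{C}$ the variables $X_{C_1},\dots,X_{C_n}$ are independent zero-mean Gaussian with variances $\sigma_{C_1},\dots,\sigma_{C_n}$. For an increasing sequence $A=\{A_n\}$ in $\mathbf{A}$, $A_n\uparrow T$ (or $A\uparrow T$) means $A_n\neq T$ for all $n$ and $\overline{\bigcup_n A_n}=T$.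
   Formalization: The formal theorem additionally assumes that the union of the A_n has infinite σ-measure; without this the claim fails, e.g. for Brownian motion on T=[0,1] with Lebesgue σ and A_n=[0,1−1/(n+1)], and it is necessary for (b). *)

(* Defs.v *)
From HB Require Import structures.
From mathcomp Require Import all_boot all_order all_algebra.
From mathcomp Require Import all_classical all_reals all_analysis.
Set Implicit Arguments.
Unset Strict Implicit.
Unset Printing Implicit Defensive.
Import Order.TTheory GRing.Theory Num.Theory.
Import numFieldNormedType.Exports.
Local Open Scope classical_set_scope.
Local Open Scope ring_scope.

(* A nonvoid topological space is a [ptopologicalType]; [borel T] is the same
   carrier equipped with the sigma-algebra generated by the open sets. *)
Notation borel T := (g_sigma_algebraType (@open T)).

Definition sigma_compact (T : topologicalType) (D : set T) : Prop :=
  exists2 K : (set T)^nat, (forall n, compact (K n)) & D = \bigcup_n K n.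

Definition increasing_in (T : Type) (A : set (set T)) (F : (set T)^nat) : Prop :=
  (forall n, A (F n)) /\ (forall m n, (m <= n)%N -> F m `<=` F n).

(* The members of the class are compact but T need not be Hausdorff, so they
   are not assumed closed. The sequence B of the exhaustion is the one that
   bounds the increasing sequences in the closure condition, hence its scope.
   Intersections range over nonempty subclasses: the empty intersection would
   be T, which need not be compact. *)
Definition indexing_collection (T : ptopologicalType) (A : set (set T)) : Prop :=
  [/\ forall D, A D -> compact D /\ connected D,
      A set0,
      exists2 B : (set T)^nat,
        increasing_in A B /\ \bigcup_n (B n)° = [set: T] &
        forall F : (set T)^nat, increasing_in A F ->
          (exists n, forall i, F i `<=` B n) -> A (closure (\bigcup_i F i)),
      (forall G : set (set T), G !=set0 -> G `<=` A ->
         A (\bigcap_(D in G) D)) /\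
      (forall D E, A D -> A E -> D !=set0 -> E !=set0 -> (D `&` E) !=set0) &
      <<s A >> = <<s @open T >>].

Definition empty' (T : Type) (A : set (set T)) : set T :=
  \bigcap_(D in [set D | A D /\ D !=set0]) D.

Definition finite_unions (T : Type) (G : set (set T)) : set (set T) :=
  [set U | exists F : set (set T),
     [/\ finite_set F, F `<=` G & U = \bigcup_(D in F) D]].

Definition classC (T : Type) (A : set (set T)) : set (set T) :=
  [set C | exists D, exists B,
     [/\ A D, finite_unions A B & C = D `\` B]].

Definition classM (R : realType) (T : ptopologicalType) (A : set (set T))
    (sigma : {measure set (borel T) -> \bar R}) : Prop :=
  sigma (empty' A) = 0%E /\
  (forall D E, A D -> A E -> D !=set0 -> E !=set0 -> D `<` E ->
     (sigma D < sigma E)%E).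

Section Processes.
Context (R : realType) (d : measure_display) (Omega : measurableType d)
  (P : probability Omega R).

Definition independent_RVs (n : nat) (Z : 'I_n -> {RV P >-> R}) : Prop :=
  forall (J : {set 'I_n}) (B : 'I_n -> set R),
    (forall i, measurable (B i)) ->
    P (\bigcap_(i in [set` J]) (Z i @^-1` B i)) =
    (\prod_(i in J) P (Z i @^-1` B i))%E.

(* The variance is an extended real; the definition forces it to be finite.
   The library's [normal_prob 0 0] is a uniform law, so the degenerate Gaussian
   is given separately, as the Dirac mass at 0. *)
Definition centered_gaussian (Z : {RV P >-> R}) (v : \bar R) : Prop :=
  exists s : R, [/\ 0 <= s, v = (s ^+ 2)%:E &
    forall B : set R, measurable B ->
      distribution P Z B = if s == 0 then \d_(0 : R) B else normal_prob 0 s B].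

(* Only the values of the process X on A, and those of Y on C(u), matter. *)
Definition set_indexed_brownian_motion (T : ptopologicalType)
    (A : set (set T)) (sigma : {measure set (borel T) -> \bar R})
    (X : set T -> {RV P >-> R}) : Prop :=
  exists Y : set T -> {RV P >-> R},
    [/\ forall D, A D -> Y D = X D,
        forall C D, finite_unions (classC A) C -> finite_unions (classC A) D ->
          C `&` D = set0 ->
          {ae P, forall w, Y (C `|` D) w = Y C w + Y D w} &
        forall (n : nat) (C : 'I_n -> set T),
          (forall i, classC A (C i)) ->
          (forall i j, i != j -> C i `&` C j = set0) ->
          independent_RVs (fun i => Y (C i)) /\
          (forall i, centered_gaussian (Y (C i)) (sigma (C i)))].

End Processes.

(* This does not make sigma (F n) unbounded: for T = [0, 1], A the intervals
   [0, t] and the empty set, and sigma the Lebesgue measure, the sets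
   F n = [0, 1 - 1/(n+1)] qualify. The divergence of sigma along F is therefore
   a separate hypothesis wherever it is needed. *)
Definition increases_to_whole (T : ptopologicalType) (A : set (set T))
    (F : (set T)^nat) : Prop :=
  [/\ increasing_in A F, forall n, F n <> [set: T] &
      closure (\bigcup_n F n) = [set: T]].

(* Main.v *)
(** Write S_n = X_(A_n) and v_n = sigma(A_n). The increments of S over disjoint
    intervals of indices are independent centered Gaussian variables, and v_n
    tends to infinity.

    Lower bound in (a): Levy's maximal inequality over the block
    v_n <= 2^(k+1), the tail of the Gaussian law at the last time of the block
    and the Borel-Cantelli lemma give S_n >= - e v_n eventually, for each e > 0.

    Part (b), which also gives the upper bound in (a): along times c_k with
    v_(c_(k+1)) much larger than v_(c_k), S_(c_k) is negligible with respect to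
    the standard deviation of S_(c_(k+1)) - S_(c_k). These independent increments
    are below minus their standard deviation with probability bounded below,
    hence S takes arbitrarily negative values at arbitrarily late times. The
    upper limit is obtained from the opposite walk. *)
Require Import Defs.
From mathcomp Require Import all_boot all_order all_algebra.
From mathcomp Require Import all_classical all_reals all_analysis.
From mathcomp Require Import measurable_realfun.
From mathcomp Require Import ring lra.
Import Order.TTheory GRing.Theory Num.Theory.
Import numFieldNormedType.Exports.
Local Open Scope classical_set_scope.
Local Open Scope ring_scope.

(** * Mass bounds for centered normal laws *)

Section normal_prob_bounds.
Context {R : realType}.
Implicit Types s a : R.

Lemma normal_peakM s : 0 < s -> normal_peak s * s = normal_peak (1 : R).
Proof.
move=> s0; rewrite /normal_peak -mulrnAr sqrtrM ?sqr_ge0// sqrtr_sqr gtr0_norm//.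
by rewrite invfM expr1n mul1r mulrAC mulVf ?mul1r// gt_eqF.
Qed.

(** For [|x| <= 2 * s] the Gaussian exponent is at least [- 2], so the density is at least
    [normal_peak s * expR (- 2)]. *)
Lemma normal_prob_itv_ge s (a b : R) : 0 < s -> a < b ->
  (forall x, a <= x <= b -> x ^+ 2 <= (2 * s) ^+ 2) ->
  ((normal_peak s * expR (- 2) * (b - a))%:E <= normal_prob 0 s `[a, b])%E.
Proof.
move=> s0 ab xs.
have -> : ((normal_peak s * expR (- 2) * (b - a))%:E =
   \int[lebesgue_measure]_(x in `[a, b]) (normal_peak s * expR (- 2))%:E)%E.
  by rewrite integral_cst//= lebesgue_measure_itv/= lte_fin ab EFinM.
rewrite /normal_prob; apply: ge0_le_integral => //.
- by move=> x _; rewrite lee_fin mulr_ge0 ?expR_ge0// normal_peak_ge0.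
- apply/measurable_EFinP; apply: measurable_funTS; exact: measurable_normal_pdf.
- move=> x /=; rewrite in_itv/= => /xs xs2.
  rewrite lee_fin normal_pdfE ?gt_eqF// ler_wpM2l ?normal_peak_ge0//.
  rewrite /normal_fun ler_expR subr0 mulNr lerN2 ler_pdivrMr.
    by rewrite -mulr_natr; nra.
  by rewrite pmulrn_lgt0// exprn_gt0.
Qed.

(* Lower bound for the mass of [[- 2 * s, - s]] under the centered normal law of
   standard deviation [s]. *)
Definition kappa : R := normal_peak 1 * expR (- 2).

Lemma kappa_gt0 : 0 < kappa.
Proof. by rewrite mulr_gt0 ?expR_gt0// normal_peak_gt0. Qed.

Lemma normal_prob_le_opp s : 0 < s ->
  (kappa%:E <= normal_prob 0 s [set x | (x <= - s)%R])%E.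
Proof.
move=> s0; apply: (@le_trans _ _ (normal_prob 0 s `[- (2 * s), - s])).
  have := @normal_prob_itv_ge s (- (2 * s)) (- s) s0.
  rewrite (_ : _ * (_ - _) = kappa); last first.
    by rewrite /kappa -(normal_peakM s)//; ring.
  apply; first lra.
  by move=> x xs; nra.
apply: le_measure; rewrite ?inE//=; first by rewrite -set_itvE.
by move=> x /=; rewrite in_itv/= => /andP[].
Qed.

Lemma normal_prob_ge s : 0 < s ->
  (kappa%:E <= normal_prob 0 s [set x | (s <= x)%R])%E.
Proof.
move=> s0; apply: (@le_trans _ _ (normal_prob 0 s `[s, 2 * s])).
  have := @normal_prob_itv_ge s s (2 * s) s0.
  rewrite (_ : _ * (_ - _) = kappa); last first.
    by rewrite /kappa -(normal_peakM s)//; ring.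
  apply; first lra.
  by move=> x xs; nra.
apply: le_measure; rewrite ?inE//=; first by rewrite -set_itvE.
by move=> x /=; rewrite in_itv/= => /andP[].
Qed.

(** Serves the degenerate law, where the mass to compare with [kappa] is 1. *)
Lemma kappa_le1 : kappa <= 1.
Proof.
rewrite -lee_fin; apply: (le_trans (normal_prob_ge 1 ltr01)).
by apply: probability_le1; rewrite -set_itvE.
Qed.

Lemma measurable_norm_ge a : measurable [set x : R | a <= `|x|].
Proof.
rewrite (_ : mkset _ = [set x | x <= - a] `|` [set x | a <= x]).
  by apply: measurableU; rewrite -set_itvE.
apply/seteqP; split => x /=; rewrite ler_normr (lerNr _ x).
  by case/orP; [right|left].
by case=> ->; rewrite ?orbT.
Qed.

(* On [a <= |x|] the density of variance [s ^+ 2] is bounded by a small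
   multiple of the density of variance [(2 * s) ^+ 2], whose integral is 1. *)
Lemma normal_prob_tail s a : 0 < s -> 0 < a ->
  (normal_prob 0 s [set x | (a <= `|x|)%R] <= (8 * s ^+ 2 / a ^+ 2)%:E)%E.
Proof.
move=> s0 a0; set c := 8 * s ^+ 2 / a ^+ 2.
have c0 : 0 <= c by rewrite divr_ge0 ?sqr_ge0// mulr_ge0// sqr_ge0.
have mA := measurable_norm_ge a.
rewrite /normal_prob.
apply: (@le_trans _ _ (\int[lebesgue_measure]_(x in [set x | (a <= `|x|)%R])
    (c%:E * (normal_pdf 0 (2 * s) x)%:E)))%E.
  have pk : normal_peak s = 2 * normal_peak (2 * s).
    have s20 : 0 < 2 * s by lra.
    apply: (@mulIf _ s); rewrite ?gt_eqF//.
    by rewrite /= normal_peakM// -(normal_peakM _ s20); ring.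
  apply: ge0_le_integral => //.
  - by move=> x _; rewrite lee_fin normal_pdf_ge0.
  - apply/measurable_EFinP; apply: measurable_funTS; exact: measurable_normal_pdf.
  - apply: emeasurable_funM => //; apply/measurable_EFinP.
    by apply: measurable_funTS; exact: measurable_normal_pdf.
  move=> x /= ax; rewrite lee_fin !normal_pdfE ?gt_eqF//; last lra.
  rewrite pk -mulrA mulrCA (mulrCA c) ler_wpM2l ?normal_peak_ge0//.
  rewrite /normal_fun !subr0; set t := x ^+ 2 / s ^+ 2.
  (* The part [t / 8] of the exponent is that of the wider law. The remaining factor is at most
     [c / 2], since [8 <= c * t] and [expR (3 / 8 * t) >= 1 + 3 / 8 * t]. *)
  have -> : - x ^+ 2 / (s ^+ 2 *+ 2) = - (3 / 8 * t) + - (t / 8).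
    by rewrite /t; field; lra.
  have -> : - x ^+ 2 / ((2 * s) ^+ 2 *+ 2) = - (t / 8).
    by rewrite /t; field; lra.
  rewrite expRD mulrA ler_wpM2r ?expR_ge0//.
  have ct : 8 <= c * t.
    rewrite /c /t (_ : _ * _ = 8 * (x ^+ 2 / a ^+ 2)); last by field; lra.
    have : 1 <= x ^+ 2 / a ^+ 2.
      rewrite ler_pdivlMr ?exprn_gt0// mul1r -(real_normK (num_real x)).
      by rewrite lerXn2r ?nnegrE//; lra.
    lra.
  have t0 : 0 < t by nra.
  rewrite expRN ler_pdivrMr ?expR_gt0//.
  have /= := expR_ge1Dx (3 / 8 * t); nra.
rewrite ge0_integralZl//=; last 2 first.
- apply/measurable_EFinP; apply: measurable_funTS; exact: measurable_normal_pdf.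
- by move=> x _; rewrite lee_fin normal_pdf_ge0.
rewrite -[leRHS]mule1 lee_pmul//.
- by apply: integral_ge0 => x _; rewrite lee_fin normal_pdf_ge0.
- exact: (@probability_le1 _ _ _ (normal_prob 0 (2 * s))).
Qed.

End normal_prob_bounds.

(** * The same bounds for Gaussian variables, Dirac case included *)

Section centered_gaussian_bounds.
Context {R : realType} {d : measure_display} {Omega : measurableType d}
  {P : probability Omega R}.
Implicit Types (Z : {RV P >-> R}) (v a : R).

Lemma centered_gaussian_tail Z v a : centered_gaussian Z v%:E -> 0 < a ->
  (P [set w | (a <= `|Z w|)%R] <= (8 * v / a ^+ 2)%:E)%E.
Proof.
move=> [s [s0 [->] Zs]] a0; have := Zs _ (measurable_norm_ge a).
rewrite /distribution /pushforward /preimage /= => ->; case: eqVneq => [s00|sn0].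
  rewrite s00 expr0n/= mulr0 mul0r diracE memNset//= normr0.
  by apply/negP; rewrite -ltNge.
by apply: normal_prob_tail => //; rewrite lt_neqAle eq_sym sn0.
Qed.

Lemma centered_gaussian_le Z v : centered_gaussian Z v%:E ->
  (kappa%:E <= P [set w | (Z w <= - Num.sqrt v)%R])%E.
Proof.
move=> [s [s0 [->] Zs]]; rewrite sqrtr_sqr ger0_norm//.
have /Zs : measurable [set x : R | x <= - s] by rewrite -set_itvE.
rewrite /distribution /pushforward /preimage /= => ->; case: eqVneq => [s00|sn0].
  by rewrite s00 diracE mem_set/= ?oppr0// lee_fin kappa_le1.
by apply: normal_prob_le_opp; rewrite lt_neqAle eq_sym sn0.
Qed.

Lemma centered_gaussian_ge Z v : centered_gaussian Z v%:E ->
  (kappa%:E <= P [set w | (Num.sqrt v <= Z w)%R])%E.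
Proof.
move=> [s [s0 [->] Zs]]; rewrite sqrtr_sqr ger0_norm//.
have /Zs : measurable [set x : R | s <= x] by rewrite -set_itvE.
rewrite /distribution /pushforward /preimage /= => ->; case: eqVneq => [s00|sn0].
  by rewrite s00 diracE mem_set/= // lee_fin kappa_le1.
by apply: normal_prob_ge; rewrite lt_neqAle eq_sym sn0.
Qed.

End centered_gaussian_bounds.

(** * Independence of a variable from the preceding ones *)

Section independent_random_variables.
Context {R : realType} {d : measure_display} {Omega : measurableType d}
  {P : probability Omega R}.
Implicit Types (xi : nat -> {RV P >-> R}) (n : nat).

Lemma le_measure_ae (A B : set Omega) : measurable A -> measurable B ->
  {ae P, forall w, A w -> B w} -> (P A <= P B)%E.
Proof.
move=> mA mB [N [mN N0 NAB]]; apply: (@le_trans _ _ (P (B `|` N))).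
  apply: le_measure; rewrite ?inE//; first exact: measurableU.
  move=> w Aw; have [|nBw] := pselect (B w); first by left.
  by right; apply: NAB => /= /(_ Aw).
rewrite (le_trans (measureU2 _ mB mN))// [X in (_ + X)%E](_ : _ = 0%E) ?adde0//.
Qed.

(** A pi-system generating the sigma-algebra of the first [n] variables. *)
Definition cylinder xi n : set (set Omega) :=
  [set G | exists2 B : (set R)^nat, (forall i, measurable (B i)) &
     G = \bigcap_(i < n) xi i @^-1` B i].

Lemma cylinder_setI xi n : setI_closed (cylinder xi n).
Proof.
move=> _ _ [B mB ->] [C mC ->]; exists (fun i => B i `&` C i).
  by move=> i; exact: measurableI.
by rewrite -bigcapI; apply: eq_bigcapr => i _; rewrite preimage_setI.
Qed.

Lemma cylinder_measurable xi n : <<s cylinder xi n >> `<=` measurable.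
Proof.
apply: smallest_sub; first exact: sigma_algebra_measurable.
move=> _ [B mB ->]; apply: bigcap_measurableType => i _.
exact: measurable_funPTI.
Qed.

Lemma independent_RVs_bigcap xi n (B : (set R)^nat) :
  independent_RVs (fun i : 'I_n => xi i) -> (forall i, measurable (B i)) ->
  (P (\bigcap_(i < n) xi i @^-1` B i) = \prod_(i < n) P (xi i @^-1` B i))%E.
Proof.
move=> /(_ [set: 'I_n]%SET (fun i => B i)) ind mB.
rewrite (_ : \bigcap_(i < n) _ =
  \bigcap_(i in [set` [set: 'I_n]%SET]) xi i @^-1` B i).
  by rewrite ind//; apply: eq_bigl => i; rewrite finset.in_setT.
apply/seteqP; split => w /= h i => [_|/= ni]; first exact: h (ltn_ord i).
by have := h (Ordinal ni); rewrite /= finset.in_setT; exact.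
Qed.

(** Dynkin's argument: the events [G] satisfying the product formula form a lambda-system that
    contains the pi-system of cylinders. *)
Lemma independent_cylinder xi n G (B : set R) :
  independent_RVs (fun i : 'I_n.+1 => xi i) ->
  <<s cylinder xi n >> G -> measurable B ->
  (P (G `&` xi n @^-1` B) = P G * P (xi n @^-1` B))%E.
Proof.
move=> ind sG mB; set H := xi n @^-1` B.
have mH : measurable H by exact: measurable_funPTI.
pose L := [set G | measurable G /\ P (G `&` H) = (P G * P H)%E].
suff : <<s cylinder xi n >> `<=` L by move=> /(_ _ sG)[].
apply: lambda_system_subset => //; first exact: cylinder_setI.
  apply/dynkin_lambda_system; split.
  - by split => //; rewrite setTI probability_setT mul1e.
  - move=> A [mA AH]; split; first exact: measurableC.
    rewrite setIC -setDE measureD//; last first.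
      by rewrite (le_lt_trans (probability_le1 _ mH))// ltry.
    rewrite (setIC H A) -[LHS]/(P H - P (A `&` H))%E AH probability_setC//.
    rewrite muleBl ?mul1e//.
    exact: fin_num_measure.
  - move=> F tF LF; have mF k : measurable (F k) by have [] := LF k.
    split; first exact: bigcupT_measurable.
    rewrite setI_bigcupl measure_bigcup//; last 2 first.
    + by move=> k _; exact: measurableI.
    + exact: trivIset_setIr.
    rewrite measure_bigcup// muleC -[P H]fineK ?fin_num_measure//.
    rewrite -nneseriesZl//; apply: eq_eseriesr => k _.
    by rewrite muleC fineK ?fin_num_measure//; have [] := LF k.
move=> _ [C mC ->]; split.
  by apply: bigcap_measurableType => i _; exact: measurable_funPTI.
(* [E A] completes the constraints [C] by [A] at index [n], so that joint independence applies. The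
   choice [A = setT] then identifies the product over [i < n] with the probability of the
   cylinder. *)
pose E A i := if (i < n)%N then C i else A.
have mE A i : measurable A -> measurable (E A i) by rewrite /E; case: ifP.
have PE A : measurable A -> P ((\bigcap_(i < n) xi i @^-1` C i) `&` xi n @^-1` A) =
    (\prod_(i < n) P (xi i @^-1` C i) * P (xi n @^-1` A))%E.
  move=> mA; rewrite (_ : _ `&` _ = \bigcap_(i < n.+1) xi i @^-1` E A i).
    rewrite independent_RVs_bigcap//; last by move=> i; exact: mE.
    rewrite big_ord_recr/= {2}/E ltnn; congr (_ * _)%E.
    by apply: eq_bigr => i _; rewrite /E ltn_ord.
  apply/seteqP; split => w /=.
    move=> [wC wA] i /=; rewrite /E ltnS leq_eqVlt => /predU1P[->|ni].
      by rewrite ltnn.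
    by rewrite ni; exact: wC.
  move=> wE; split; last by have := wE n (ltnSn n); rewrite /E /= ltnn.
  by move=> i /= ni; have := wE i (ltnW ni); rewrite /E /= ni.
have := PE setT measurableT.
by rewrite preimage_setT setIT probability_setT mule1 PE// => ->.
Qed.

End independent_random_variables.

(** * Walks and Levy's maximal inequality *)

Section walks.
Context {R : realType} {d : measure_display} {Omega : measurableType d}
  {P : probability Omega R}.
Implicit Types (D : nat -> nat -> {RV P >-> R}) (m n : nat) (a p : R).

Lemma measurable_lt (f : Omega -> R) a :
  measurable_fun setT f -> measurable [set w | f w < a].
Proof.
move=> mf; rewrite (_ : mkset _ = setT `&` f @^-1` `]-oo, a[); first exact: mf.
by rewrite setTI; apply/seteqP; split => w /=; rewrite in_itv.
Qed.

Lemma measurable_le (f : Omega -> R) a :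
  measurable_fun setT f -> measurable [set w | f w <= a].
Proof.
move=> mf; rewrite (_ : mkset _ = setT `&` f @^-1` `]-oo, a]); first exact: mf.
by rewrite setTI; apply/seteqP; split => w /=; rewrite in_itv.
Qed.

(* [D m n] is the increment over [(m, n]] of the walk [D 0], whose value at 0
   is 0. *)
Definition additive_increments D : Prop :=
  {ae P, forall w m n, (m <= n)%N -> D 0 n w = D 0 m w + D m n w}.

Definition independent_increments D : Prop :=
  forall (c : nat -> nat) n, {homo c : i j / (i <= j)%N} ->
    independent_RVs (fun i : 'I_n => D (c i) (c i.+1)).

(* If the walk first goes below [- a] at time [j <= n], then with conditional
   probability at least [p] the later increment [D j n] is nonpositive. *)
Lemma levy_inequality D n a p : additive_increments D ->
  independent_increments D -> 0 <= p ->
  (forall j, (j <= n)%N -> p%:E <= P [set w | (D j n w <= 0)%R])%E ->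
  (p%:E * P (\bigcup_(j < n.+1) [set w | (D 0 j w < - a)%R]) <=
   P [set w | (D 0 n w < - a)%R])%E.
Proof.
move=> addD indD p0 Hp.
(* [D 0 j] is the sum of the unit increments only almost surely, whereas [T j] is everywhere a
   function of them, hence measurable for their sigma-algebra. *)
pose T (j : nat) := fun w => \sum_(i < j) D i i.+1 w.
have addT : {ae P, forall w, [/\ forall j, D 0 j w = T j w &
    forall j n, (j <= n)%N -> D 0 n w = D 0 j w + D j n w]}.
  apply: filterS addD => w h; split=> //; elim=> [|j IH].
    by rewrite /T big_ord0; apply: (addrI (D 0 0 w)); rewrite addr0 -h.
  by rewrite (h j)// IH /T big_ord_recr.
have mT j : measurable_fun setT (T j).
  by apply: measurable_sum => i.
pose F j := [set w | T j w < - a].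
have mF j : measurable (F j) by exact: measurable_lt.
(* [seqDU F j] is the event that [T] is below [- a] for the first time at [j]. *)
have mE j : measurable (seqDU F j) by exact: seqDU_measurable.
pose H j := [set w | D j n w <= 0].
have mH j : measurable (H j) by exact: measurable_le.
have indE j : (j <= n)%N -> (P (seqDU F j `&` H j) = P (seqDU F j) * P (H j))%E.
  (* Times jump to [n] after [j]: increment number [j] is [D j n], and those before it are the unit
     ones. *)
  move=> jn; pose c i := if (i <= j)%N then i else n.
  have hc : {homo c : i j / (i <= j)%N}.
    move=> x y xy; rewrite /c; case: (leqP x j) => xj; case: (leqP y j) => yj //.
      exact: leq_trans xj jn.
    by have := leq_trans xj (leq_trans xy yj); rewrite ltnn.
  pose xi i := D (c i) (c i.+1).
  have xij : xi j = D j n by rewrite /xi /c leqnn ltnn.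
  have -> : H j = xi j @^-1` `]-oo, 0].
    by rewrite xij; apply/seteqP; split => w /=; rewrite in_itv.
  apply: independent_cylinder => //; first exact: indD.
  (* [C] is [Omega] with the sigma-algebra of the first [j] increments, for which first passage at
     [j] is measurable. *)
  pose C : Type := g_sigma_algebraType (cylinder xi j).
  have mxi i : (i < j)%N -> measurable_fun [set: C] (D i i.+1 : C -> R).
    move=> ij; have -> : D i i.+1 = xi i by rewrite /xi /c (ltnW ij) ij.
    move=> _ B mB; rewrite setTI; apply: sub_gen_smallest.
    exists (fun k => if k == i then B else setT); first by move=> k; case: ifP.
    apply/seteqP; split => w /=; last by move=> /(_ i ij) /=; rewrite eqxx.
    by move=> wB k _ /=; case: eqVneq => // ->.
  have mTC k : (k <= j)%N -> measurable_fun [set: C] (T k : C -> R).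
    move=> kj; pose g (i : nat) : C -> R := if (i < j)%N then D i i.+1 else cst 0.
    have -> : T k = (fun w => \sum_(i < k) g i w).
      apply/funext => w; apply: eq_bigr => i _.
      by rewrite /g (leq_trans (ltn_ord i) kj).
    apply: (@measurable_sum _ _ _ _ _ _ (fun i : 'I_k => g i)) => i; rewrite /g.
    by case: ltnP => [/mxi//|_]; exact: measurable_cst.
  have mFC k : (k <= j)%N -> measurable (F k : set C).
    move=> kj; rewrite (_ : F k = setT `&` (T k : C -> R) @^-1` `]-oo, - a[).
      exact: mTC.
    by rewrite setTI; apply/seteqP; split => w /=; rewrite in_itv.
  have : measurable (seqDU F j : set C); last by [].
  apply: measurableD; first exact: mFC.
  by apply: bigsetU_measurable => k _; apply: mFC; exact: ltnW.
have mW j : measurable [set w | D 0 j w < - a] by exact: measurable_lt.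
apply: (@le_trans _ _ (p%:E * P (\bigcup_(j < n.+1) F j))%E).
  apply: lee_pmul => //; apply: le_measure_ae.
  - by apply: bigcup_measurable.
  - by apply: bigcup_measurable.
  apply: filterS addT => w [h _] [j jn /= wj]; exists j => //.
  by rewrite /F /= -h.
rewrite bigcup_mkord bigsetU_seqDU measure_semi_additive_ord_I//; last 2 first.
- by apply: sub_trivIset (trivIset_seqDU F).
- by apply: bigsetU_measurable.
rewrite ge0_sume_distrr//.
apply: (@le_trans _ _ (\sum_(i < n.+1) P (seqDU F i `&` H i))%E).
  apply: lee_sum => i _; rewrite indE -1?ltnS// muleC.
  by apply: lee_pmul => //; apply: Hp; rewrite -ltnS.
rewrite -(@measure_semi_additive_ord_I _ _ _ P (fun i => seqDU F i `&` H i))//;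
  last 3 first.
- by move=> k _; exact: measurableI.
- by apply: trivIset_setIr; apply: sub_trivIset (trivIset_seqDU F).
- by apply: bigsetU_measurable => i _; exact: measurableI.
apply: le_measure_ae => //.
  by apply: bigsetU_measurable => i _; exact: measurableI.
(* First passage at [j] followed by [D j n <= 0] leaves the walk below [- a] at time [n]. *)
apply: filterS addT => w [hT hD].
rewrite -(bigcup_mkord n.+1 (fun i => seqDU F i `&` H i)) => -[j /= jn [[Fj _] Hj]].
rewrite (hD j)// hT; move: Fj Hj; rewrite /F /H /= => ? ?; lra.
Qed.

End walks.

(** * Eventual lower bound for the walk *)

Section lower_bound.
Context {R : realType} {d : measure_display} {Omega : measurableType d}
  {P : probability Omega R}.

(* Along the blocks [v <= 2 ^ k.+1], Levy's inequality and the tail estimate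
   at the last time of the block give summable bounds. *)
Lemma walk_ge_eventually (D : nat -> nat -> {RV P >-> R}) (v : nat -> R) (e : R) :
  additive_increments D -> independent_increments D ->
  (forall m n, (m <= n)%N -> centered_gaussian (D m n) (v n - v m)%:E) ->
  {homo v : m n / (m <= n)%N >-> m <= n} -> v 0 = 0 ->
  (forall M, exists n, M < v n) -> 0 < e ->
  {ae P, forall w, exists n0, forall n, (n0 <= n)%N -> - (e * v n) <= D 0 n w}.
Proof.
move=> addD indD gD ndv v0 vy e0.
have k0 := kappa_gt0 (R := R).
pose b (k : nat) : R := (2 ^ k.+1)%:R.
have b0 k : 0 < b k by rewrite ltr0n expn_gt0.
have bS k : b k.+1 = 2 * b k by rewrite /b expnS natrM.
have bN M : exists k, M <= b k.
  have [M0|/ltW M0] := leP 0 M; last by exists 0; rewrite (le_trans M0) ?ltW.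
  exists (Num.bound M); apply: ltW; rewrite /b natrX.
  by apply: upper_nthrootP; exact: leqnSn.
(* The last time with [v <= b k]; it exists because [v] is monotone and unbounded. *)
have mN k : exists m, v m <= b k /\ forall n, v n <= b k -> (n <= m)%N.
  have [N vN] := vy (b k).
  have exP : exists n, v n <= b k by exists 0; rewrite v0 ltW.
  have ubP n : v n <= b k -> (n <= N)%N.
    by move=> vn; rewrite leqNgt; apply/negP => /ltnW /ndv; lra.
  by case: (ex_maxnP exP ubP) => m vm hm; exists m.
have {mN} [m mP] := choice mN.
(* [b k / 2] is the lower end of block [k], so [e * v n] exceeds this threshold at every time [n] of
   the block. *)
pose G k := \bigcup_(j < (m k).+1) [set w | D 0 j w < - (e * b k / 2)].
have mG k : measurable (G k).
  by apply: bigcup_measurable => j _; exact: measurable_lt.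
(* The tail bound [8 * b k / (e * b k / 2) ^+ 2], divided by Levy's constant [kappa], is [c / b k],
   which is summable. *)
pose c : R := 32 / (kappa * e ^+ 2).
have c0 : 0 <= c by rewrite divr_ge0// mulr_ge0// ?sqr_ge0// ltW.
have PG k : (P (G k) <= (c / (2 ^ k.+1)%:R)%:E)%E.
  rewrite -(@lee_pmul2l _ kappa%:E)//.
  apply: le_trans.
    apply: levy_inequality => //; first exact: ltW.
    move=> j jm; apply: le_trans (centered_gaussian_le _ _ (gD j (m k) jm)) _.
    apply: le_measure; rewrite ?inE; [exact: measurable_le|exact: measurable_le|].
    by move=> w /= /le_trans; apply; rewrite oppr_le0 sqrtr_ge0.
  have ebk : 0 < e * b k / 2 by rewrite divr_gt0// mulr_gt0.
  apply: (@le_trans _ _ (P [set w | (e * b k / 2 <= `|D 0 (m k) w|)%R])).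
    apply: le_measure; rewrite ?inE; first exact: measurable_lt.
      rewrite (_ : mkset _ = D 0 (m k) @^-1` [set x | e * b k / 2 <= `|x|])//.
      by apply: measurable_funPTI; exact: measurable_norm_ge.
    by move=> w /= wlt; rewrite ler_normr; apply/orP; right; lra.
  apply: le_trans (centered_gaussian_tail _ _ _ (gD 0 (m k) (leq0n _)) ebk) _.
  rewrite v0 subr0 -EFinM lee_fin -/(b k) ler_pdivrMr ?exprn_gt0//.
  have -> : kappa * (c / b k) * (e * b k / 2) ^+ 2 = 8 * b k.
    by rewrite /c; field; rewrite !gt_eqF//.
  by rewrite ler_pM2l//; exact: (mP k).1.
have : P (lim_sup_set G) = 0.
  apply: lim_sup_set_cvg0 => //.
  apply: (@le_lt_trans _ _ (\sum_(k <oo) (c / (2 ^ k.+1)%:R)%:E)%E).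
    by apply: lee_nneseries => [k _ _|k _]; [exact: measure_ge0|exact: PG].
  by rewrite (le_lt_trans (epsilon_trick0 xpredT c0))// ltry.
move=> G0; exists (lim_sup_set G); split => //.
  apply: bigcap_measurableType => k _.
  by apply: bigcup_measurable.
move=> w; apply: contra_notP; rewrite /lim_sup_set /bigcap /= => /existsNP[K].
move=> /not_implyP[_ nK].
have {}nK k : (K <= k)%N -> ~ G k w by move=> Kk Gk; apply: nK; exists k.
have [n0 vn0] := vy (b K); exists n0 => n n0n.
have vn : b K < v n by rewrite (lt_le_trans vn0)//; exact: ndv.
(* The least index with [v n <= b k] gives the block of [n]; it is not 0, as [b 0 <= b K < v n]. *)
case: (ex_minnP (bN (v n))) => -[|k] vnk kmin.
  have : b 0 <= b K by rewrite ler_nat leq_exp2l.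
  lra.
have bkv : b k < v n by rewrite ltNge; apply/negP => /kmin; rewrite ltnn.
have Kk : (K <= k.+1)%N.
  rewrite leqNgt; apply/negP => kK; have : b k.+1 <= b K.
    by rewrite ler_nat leq_exp2l// ltnS ltnW.
  lra.
rewrite leNgt; apply/negP => Dn; apply: (nK _ Kk); exists n => /=.
  by rewrite ltnS; exact: (mP k.+1).2.
rewrite (lt_le_trans Dn)// lerN2 bS; nra.
Qed.

End lower_bound.

(** * Arbitrarily negative values at late times *)

Section unbounded_walks.
Context {R : realType} {d : measure_display} {Omega : measurableType d}
  {P : probability Omega R}.

(* Along times [c k] with fast growing variances the walk at [c k] is
   negligible before the increment over [(c k, c k.+1]], and these increments
   are independent and very negative with probability at least [p]. The laws
   enter only through the two bounds, so that the opposite walk is covered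
   without using the symmetry of the normal law. *)
Lemma walk_le_frequently (D : nat -> nat -> {RV P >-> R}) (v : nat -> R) (p : R) :
  additive_increments D -> independent_increments D ->
  {homo v : m n / (m <= n)%N >-> m <= n} -> 0 <= v 0 ->
  (forall M, exists n, M < v n) ->
  (forall n (a : R), 0 < a ->
    (P [set w | (a <= `|D 0 n w|)%R] <= (8 * v n / a ^+ 2)%:E)%E) ->
  0 < p ->
  (forall m n, (m <= n)%N ->
    (p%:E <= P [set w | (D m n w <= - Num.sqrt (v n - v m))%R])%E) ->
  {ae P, forall w (M N : nat), exists2 n, (N <= n)%N & D 0 n w <= - M%:R}.
Proof.
move=> addD indD ndv v0 vy tailD p0 loD.
have vge0 n : 0 <= v n by rewrite (le_trans v0)// ndv.
have p1 : p <= 1.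
  rewrite -lee_fin (le_trans (loD 0 0 (leqnn _)))//.
  by apply: probability_le1; exact: measurable_le.
apply: ae_foralln => M; apply: ae_foralln => N.
pose bad := \bigcap_(n in [set n | (N <= n)%N]) ~` [set w | D 0 n w <= - M%:R].
have mbad : measurable bad.
  by apply: bigcap_measurableType => n _; apply: measurableC; exact: measurable_le.
suff Pbad : P bad = 0.
  exists bad; split => // w /= h n /= Nn Dn; apply: h.
  by exists n.
apply/eqP; rewrite -measure_le0; apply/lee_addgt0Pr => _/posnumP[e]; rewrite add0e.
(* [L] independent increments all miss their target with probability at most [(1 - p) ^+ L]. *)
have [L pL] : exists L, (1 - p) ^+ L < e%:num / 2.
  have /cvg_expr/cvgr0Pnorm_lt : `|1 - p| < 1 by rewrite ger0_norm; lra.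
  move=> /(_ (e%:num / 2)) /(_ _)[]; first by rewrite divr_gt0.
  move=> L _ /(_ L (leqnn L)); rewrite ger0_norm; first by exists L.
  by rewrite exprn_ge0; lra.
(* Half of [e] is shared among [L] times; [L.+1] keeps the divisor positive when [L = 0]. *)
pose dl := e%:num / (2 * L.+1%:R).
have dl0 : 0 < dl by rewrite divr_gt0// mulr_gt0// ltr0n.
(* Chosen so that [8 * v n <= dl * t n <= dl * t n ^+ 2]: the tail bound at level [t n] is at most
   [dl]. *)
pose t n := 1 + 8 * v n / dl.
have t1 n : 1 <= t n by rewrite lerDl divr_ge0 ?(ltW dl0)// mulr_ge0.
(* The next time is late enough for the standard deviation of the increment to reach [t n + M]. *)
have fP n : exists m, (n <= m)%N /\ (t n + M%:R) ^+ 2 <= v m - v n.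
  have [m vm] := vy (v n + (t n + M%:R) ^+ 2); exists (maxn n m).
  rewrite leq_maxl; split => //; rewrite lerBrDl (le_trans (ltW vm))// ndv//.
  exact: leq_maxr.
have {fP} [f fP] := choice fP.
pose c k := iter k f N.
have cS k : c k.+1 = f (c k) by [].
have hc : {homo c : i j / (i <= j)%N}.
  by apply: homo_leq; [exact: leqnn|exact: leq_trans|];
    move=> k; rewrite cS; have [] := fP (c k).
have cN k : (N <= c k)%N by exact: (hc 0 k).
(* On [U] some earlier position is not negligible; on [I] below, every increment misses its target.
   Almost surely [bad] lies in their union. *)
pose U := \big[setU/set0]_(k < L) [set w | t (c k) <= `|D 0 (c k) w|].
have mU k : measurable [set w | t (c k) <= `|D 0 (c k) w|].
  rewrite (_ : mkset _ = D 0 (c k) @^-1` [set x | t (c k) <= `|x|])//.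
  by apply: measurable_funPTI; exact: measurable_norm_ge.
pose u k := v (c k.+1) - v (c k).
pose B k : set R := ~` `]-oo, - Num.sqrt (u k)].
have mB k : measurable (B k) by exact: measurableC.
pose I := \bigcap_(k < L) D (c k) (c k.+1) @^-1` B k.
have mI : measurable I.
  by apply: bigcap_measurableType => k _; exact: measurable_funPTI.
have mbU : measurable U by exact: bigsetU_measurable.
have PU : (P U <= (e%:num / 2)%:E)%E.
  apply: (le_trans (@Boole_inequality _ _ _ P
    (fun k => [set w | t (c k) <= `|D 0 (c k) w|]) L _)).
    by move=> i _; exact: mU.
  apply: (@le_trans _ _ (\sum_(k < L) dl%:E)%E).
    apply: lee_sum => k _; apply: le_trans.
      by apply: tailD; rewrite (lt_le_trans _ (t1 _)).
    rewrite lee_fin ler_pdivrMr; last by rewrite exprn_gt0// (lt_le_trans _ (t1 _)).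
    have t8 : 8 * v (c k) <= dl * t (c k).
      have -> : dl * t (c k) = dl + 8 * v (c k).
        by rewrite /t; field; rewrite gt_eqF.
      by rewrite lerDr ltW.
    rewrite (le_trans t8)// expr2 mulrA ler_peMr// mulr_ge0 ?(ltW dl0)//.
    exact: le_trans (t1 _).
  rewrite sumEFin lee_fin sumr_const card_ord.
  rewrite (_ : dl *+ L = e%:num / 2 * (L%:R / L.+1%:R)); last first.
    rewrite /dl invfM -mulr_natl.
    by move: (e%:num) (L.+1%:R^-1 : R) => x y; ring.
  rewrite ler_piMr ?divr_ge0//.
  by rewrite ler_pdivrMr ?ltr0n// mul1r ler_nat.
have PI : (P I <= (e%:num / 2)%:E)%E.
  rewrite (@independent_RVs_bigcap _ _ _ _ (fun k => D (c k) (c k.+1)))//;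
    last exact: indD.
  apply: (@le_trans _ _ (\prod_(k < L) (1 - p)%:E)%E).
    (* Products of inequalities require nonnegative factors, so nonnegativity is carried through the
       induction. *)
    suff [] : (0 <= \prod_(k < L) P (D (c k) (c k.+1) @^-1` B k) /\
      \prod_(k < L) P (D (c k) (c k.+1) @^-1` B k) <=
      \prod_(k < L) (1 - p)%:E)%E by [].
    apply: (big_ind2 (fun x y : \bar R => 0 <= x /\ x <= y)%E).
    - by rewrite lee01.
    - by move=> x y x' y' [? ?] [? ?]; rewrite mule_ge0// lee_pmul.
    move=> k _; split; first exact: measure_ge0.
    rewrite -preimage_setC probability_setC; last exact: measurable_funPTI.
    rewrite EFinB leeB// (le_trans (loD (c k) (c k.+1) _))//.
    exact: hc.
  by rewrite prodEFin lee_fin prodr_const card_ord ltW.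
apply: (@le_trans _ _ (P (U `|` I))); last first.
  by rewrite (le_trans (measureU2 _ mbU mI))// (splitr e%:num) EFinD leeD.
apply: le_measure_ae => //; first exact: measurableU.
apply: filterS addD => w addw wbad.
have [?|nU] := pselect (U w); first by left.
right => k /= kL; rewrite /B /= in_itv/= => xk.
have tk : `|D 0 (c k) w| < t (c k).
  rewrite ltNge; apply/negP => tk; apply: nU.
  by rewrite /U -(bigcup_mkord L (fun k => [set w | t (c k) <= `|D 0 (c k) w|]));
    exists k.
(* A hit at step [k] would put the walk below [t (c k) - (t (c k) + M) = - M], contrary to [bad]. *)
have /= := wbad (c k.+1) (cN _).
apply; rewrite (addw (c k) (c k.+1)); last exact: hc.
have su : t (c k) + M%:R <= Num.sqrt (u k).
  have tM0 : 0 <= t (c k) + M%:R by rewrite addr_ge0// (le_trans _ (t1 _)).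
  rewrite -[leLHS]ger0_norm// -sqrtr_sqr ler_sqrt ?(fP (c k)).2//.
  exact: le_trans (sqr_ge0 _) (fP (c k)).2.
have := ler_norm (D 0 (c k) w); lra.
Qed.

End unbounded_walks.

(** * Criteria for lower limits *)

Section limit_inferior.
Context {R : realType}.
Implicit Types u : nat -> R.

Lemma limn_einf_Ny u :
  (forall M N : nat, exists2 n, (N <= n)%N & u n <= - M%:R) ->
  limn_einf (fun n => (u n)%:E) = -oo%E.
Proof.
move=> hu; rewrite limn_einf_lim (_ : einfs _ = cst -oo%E) ?lim_cst//.
apply/funext => N /=.
suff hx x : (einfs (fun n => (u n)%:E) N < x%:E)%E.
  by case: einfs hx => [r /(_ r)|/(_ 0)|//]; rewrite ?ltxx// ltNge leey.
have [n Nn un] := hu (Num.bound `|x|).+1 N.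
apply: (@le_lt_trans _ _ (u n)%:E); first by apply: ereal_inf_lbound; exists n.
rewrite lte_fin (le_lt_trans un)// ltrNl.
have := archi_boundP (normr_ge0 x); have := ler_norm (- x).
by rewrite -natr1 normrN; lra.
Qed.

(** The first hypothesis bounds every tail infimum above by 0, the second bounds the late ones below
    by [- e]. *)
Lemma limn_einf_eq0 u :
  (forall N, exists2 n, (N <= n)%N & u n <= 0) ->
  (forall e, 0 < e -> \forall n \near \oo, - e <= u n) ->
  limn_einf (fun n => (u n)%:E) = 0%E.
Proof.
move=> hle hge; rewrite limn_einf_lim; apply/eqP; rewrite eq_le; apply/andP; split.
  apply: lime_le; first exact: is_cvg_einfs.
  apply: nearW => N; have [n Nn un] := hle N.
  by apply: (@le_trans _ _ (u n)%:E) => //; apply: ereal_inf_lbound; exists n.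
apply/lee_subgt0Pr => e e0; rewrite sub0e -EFinN.
apply: lime_ge; first exact: is_cvg_einfs.
have [N _ hN] := hge e e0; exists N => // m /= Nm.
apply: le_ereal_inf_tmp => _ [n /= mn <-]; rewrite lee_fin.
by apply: hN => /=; exact: leq_trans mn.
Qed.

End limit_inferior.

(** * The opposite walk *)

Section opposite_walk.
Context {R : realType} {d : measure_display} {Omega : measurableType d}
  {P : probability Omega R}.

Definition opp_increments (D : nat -> nat -> {RV P >-> R}) m n : {RV P >-> R} :=
  - D m n.

Lemma opp_incrementsE D m n w : opp_increments D m n w = - D m n w.
Proof. by []. Qed.

Lemma additive_increments_opp D : additive_increments D ->
  additive_increments (opp_increments D).
Proof.
apply: filterS => w h m n mn.
by rewrite !opp_incrementsE (h m n)// opprD.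
Qed.

Lemma independent_increments_opp D : independent_increments D ->
  independent_increments (opp_increments D).
Proof.
move=> indD c n hc J B mB.
have := indD c n hc J (fun i => -%R @^-1` B i).
apply => i; rewrite -[X in measurable X]setTI.
by apply: oppr_measurable.
Qed.

End opposite_walk.

(** * The walk attached to an increasing sequence of sets *)

Section brownian_walk.
Context {R : realType} {T : ptopologicalType} {A : set (set T)}
  {sigma : {measure set (borel T) -> \bar R}}
  {d : measure_display} {Omega : measurableType d} {P : probability Omega R}
  {Y : set T -> {RV P >-> R}} {F : (set T)^nat}.
Context (A0 : A set0) (AB : <<s A >> = <<s @open T >>) (AF : increasing_in A F).
Context (Yadd : forall C D, finite_unions (classC A) C ->
     finite_unions (classC A) D -> C `&` D = set0 ->
     {ae P, forall w, Y (C `|` D) w = Y C w + Y D w}).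
Context (Yind : forall (n : nat) (C : 'I_n -> set T), (forall i, classC A (C i)) ->
     (forall i j, i != j -> C i `&` C j = set0) ->
     independent_RVs (fun i => Y (C i)) /\
     (forall i, centered_gaussian (Y (C i)) (sigma (C i)))).

(* With the empty set prepended, [Y (F n)] is the increment of the walk from
   time 0 to time [n.+1]. *)
Definition cons_set0 (n : nat) : set T := if n is k.+1 then F k else set0.
Local Notation E := cons_set0.

Definition set_increment m n : {RV P >-> R} := Y (E n `\` E m).
Definition set_variance n : R := fine (sigma (E n)).

Lemma cons_set0_in n : A (E n).
Proof. by case: n => //= n; have [] := AF. Qed.

Lemma cons_set0_homo m n : (m <= n)%N -> E m `<=` E n.
Proof.
by case: m n => [|m] [|n] //= mn; [exact: sub0set..|have [_] := AF; apply].
Qed.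

Lemma finite_unions1 (G : set (set T)) C : G C -> finite_unions G C.
Proof.
by move=> GC; exists [set C]; split => //; [move=> _ ->|rewrite bigcup_set1].
Qed.

Lemma classC_diff m n : classC A (E n `\` E m).
Proof.
exists (E n), (E m); split => //; first exact: cons_set0_in.
by apply: finite_unions1; exact: cons_set0_in.
Qed.

Lemma measurable_cons_set0 n : measurable (E n : set (borel T)).
Proof.
suff : <<s @open T >> (E n) by [].
by rewrite -AB; apply: sub_gen_smallest; exact: cons_set0_in.
Qed.

Lemma centered_gaussian_classC C :
  classC A C -> centered_gaussian (Y C) (sigma C).
Proof.
move=> AC; have [_ gC] := Yind 1 (fun=> C) (fun=> AC)
  (fun i j => ltac:(by rewrite !ord1)).
exact: gC ord0.
Qed.

(** Gaussian variances are real, so [sigma] is finite on [E n], which is the increment from time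
    0. *)
Lemma set_varianceE n : sigma (E n) = (set_variance n)%:E.
Proof.
rewrite /set_variance fineK//; have := centered_gaussian_classC _ (classC_diff 0 n).
by rewrite setD0 => -[s [_ -> _]].
Qed.

Lemma set_varianceB m n : (m <= n)%N ->
  sigma (E n `\` E m) = (set_variance n - set_variance m)%:E.
Proof.
move=> mn; rewrite measureD; [|exact: measurable_cons_set0..|].
  rewrite setIidr; last exact: cons_set0_homo.
  by rewrite EFinB -!set_varianceE.
by rewrite -[ltLHS]/(sigma (E n)) set_varianceE ltry.
Qed.

Lemma centered_gaussian_increment m n : (m <= n)%N ->
  centered_gaussian (set_increment m n) (set_variance n - set_variance m)%:E.
Proof.
by move=> mn; rewrite -set_varianceB//; exact/centered_gaussian_classC/classC_diff.
Qed.

Lemma set_variance_homo : {homo set_variance : m n / (m <= n)%N >-> m <= n}.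
Proof.
by move=> m n /set_varianceB sB; rewrite -subr_ge0 -lee_fin -sB measure_ge0.
Qed.

Lemma set_variance0 : set_variance 0 = 0.
Proof. by rewrite /set_variance /= measure0. Qed.

(** By continuity from below, a bound on all the variances would bound the measure of the union. *)
Lemma set_variance_unbounded : sigma (\bigcup_n F n) = +oo%E ->
  forall M, exists n, M < set_variance n.
Proof.
move=> sF M; apply: contrapT => /forallNP vM.
have : (sigma (\bigcup_n E n) <= M%:E)%E.
  have ndE : nondecreasing_seq (E : (set (borel T))^nat).
    by move=> m n mn; apply/subsetPset; exact: cons_set0_homo.
  have /cvg_lim <- // := @nondecreasing_cvg_mu _ _ _ sigma E measurable_cons_set0
    (bigcupT_measurable _ measurable_cons_set0) ndE.
  apply: lime_le.
    apply: ereal_nondecreasing_is_cvgn => m n mn.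
    by rewrite /= !set_varianceE lee_fin set_variance_homo.
  apply: nearW => n /=; rewrite set_varianceE lee_fin leNgt.
  exact/negP/vM.
rewrite (_ : \bigcup_n E n = \bigcup_n F n) ?sF//.
by apply/seteqP; split => w [[|n] _ //= wn]; [exists n|exists 1|exists n.+2].
Qed.

Lemma additive_set_increment : additive_increments set_increment.
Proof.
apply: ae_foralln => m; apply: ae_foralln => n.
have [mn|nm] := leqP m n; last exact: aeW.
have CE k l : finite_unions (classC A) (E k `\` E l).
  by apply: finite_unions1; exact: classC_diff.
have disj : (E m `\` E 0) `&` (E n `\` E m) = set0.
  by apply/seteqP; split => // x [[? _] []].
apply: filterS (Yadd _ _ (CE m 0) (CE n m) disj) => w + _.
rewrite /set_increment !setD0 setDUK//; exact: cons_set0_homo.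
Qed.

(** Along monotone times the successive differences are pairwise disjoint: a later one removes a set
    containing the earlier one. *)
Lemma independent_set_increment : independent_increments set_increment.
Proof.
move=> c n hc; apply: (Yind n (fun i => E (c i.+1) `\` E (c i)) _ _).1
  => [i|i j ij].
  exact: classC_diff.
have disj (k l : nat) : (k < l)%N ->
    (E (c k.+1) `\` E (c k)) `&` (E (c l.+1) `\` E (c l)) = set0.
  move=> kl; apply/seteqP; split => // x [[xk _] [_ xl]]; apply: xl.
  exact: cons_set0_homo (hc _ _ kl) _ xk.
by case: (ltngtP i j) => [/disj//|/disj|/val_inj/eqP]; rewrite ?(negPf ij)// setIC.
Qed.

End brownian_walk.

(** * Limits of the process along the sequence *)

Theorem corollary7 (R : realType) (T : ptopologicalType)
    (T_sigma_compact : sigma_compact [set: T])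
    (T_connected : connected [set: T])
    (A : set (set T)) (A_indexing : indexing_collection A)
    (sigma : {measure set (borel T) -> \bar R}) (sigmaM : classM A sigma)
    (d : measure_display) (Omega : measurableType d) (P : probability Omega R)
    (X : set T -> {RV P >-> R})
    (X_bm : set_indexed_brownian_motion A sigma X)
    (A_ : (set T)^nat) (A_T : increases_to_whole A A_)
    (sigma_infty : sigma (\bigcup_n A_ n) = +oo%E) :
  {ae P, forall w,
     limn_einf (fun n => (X (A_ n) w / fine (sigma (A_ n)))%:E) = 0%E} /\
  (P [set w | limn_einf (fun n => (X (A_ n) w)%:E) = -oo%E] = 1%E /\
   P [set w | limn_esup (fun n => (X (A_ n) w)%:E) = +oo%E] = 1%E).
Proof.
have [_ A0 _ _ AB] := A_indexing; have [AF _ _] := A_T.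
have [Y [YX Yadd Yind]] := X_bm.
pose D := @set_increment R T d Omega P Y A_.
pose v := @set_variance R T sigma A_.
have addD : additive_increments D := additive_set_increment A0 AF Yadd.
have indD : independent_increments D.
  exact: (independent_set_increment A0 AF Yind).
have gD m n : (m <= n)%N -> centered_gaussian (D m n) (v n - v m)%:E.
  exact: (centered_gaussian_increment A0 AB AF Yind).
have ndv : {homo v : m n / (m <= n)%N >-> m <= n}.
  exact: (set_variance_homo A0 AB AF Yind).
have v0 : v 0 = 0 by exact: set_variance0.
have vy : forall M, exists n, M < v n.
  exact: (set_variance_unbounded A0 AB AF Yind).
have XD n : X (A_ n) = D 0 n.+1.
  by rewrite /D /set_increment /= setD0 YX//; by have [AA _] := AF; exact: AA.
have tailD n (a : R) : 0 < a ->
    (P [set w | (a <= `|D 0 n w|)%R] <= (8 * v n / a ^+ 2)%:E)%E.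
  move=> a0; have := centered_gaussian_tail _ _ _ (gD 0 n (leq0n n)) a0.
  by rewrite v0 subr0.
have lo : {ae P, forall w (M N : nat), exists2 n, (N <= n)%N & D 0 n w <= - M%:R}.
  apply: (@walk_le_frequently _ _ _ _ D v kappa) => //.
  - by rewrite v0.
  - exact: kappa_gt0.
  - by move=> m n mn; exact: centered_gaussian_le (gD m n mn).
have hi : {ae P, forall w (M N : nat), exists2 n, (N <= n)%N & M%:R <= D 0 n w}.
  have : {ae P, forall w (M N : nat),
      exists2 n, (N <= n)%N & opp_increments D 0 n w <= - M%:R}.
    apply: (@walk_le_frequently _ _ _ _ (opp_increments D) v kappa) => //.
    - exact: additive_increments_opp.
    - exact: independent_increments_opp.
    - by rewrite v0.
    - move=> n a a0; rewrite (_ : mkset _ = [set w | a <= `|D 0 n w|]) ?tailD//.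
      by apply: eq_set => w; rewrite opp_incrementsE normrN.
    - exact: kappa_gt0.
    - move=> m n mn; apply: le_trans (centered_gaussian_ge _ _ (gD m n mn)) _.
      rewrite (_ : mkset _ =
        [set w | opp_increments D m n w <= - Num.sqrt (v n - v m)])//.
      by apply: eq_set => w; rewrite opp_incrementsE lerN2.
  apply: filterS => w h M N; have [n Nn Dn] := h M N; exists n => //.
  by rewrite -lerN2.
(* [X (A_ n)] is the walk at time [n.+1]; asking for times from [N.+1] on excludes time 0. *)
have shift (Q : R -> Prop) w :
    (forall N : nat, exists2 n, (N <= n)%N & Q (D 0 n w)) ->
    forall N : nat, exists2 n, (N <= n)%N & Q (X (A_ n) w).
  move=> h N; have [[//|n] Nn Qn] := h N.+1; exists n => //; by rewrite XD.
have prob1 (Q : set Omega) : measurable Q -> {ae P, forall w, Q w} -> P Q = 1%E.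
  move=> mQ /negligibleP; rewrite /= => /(_ (measurableC mQ)) PQ.
  by rewrite -[Q]setCK probability_setC ?PQ ?sube0//; exact: measurableC.
have mX n : measurable_fun setT (fun w => (X (A_ n) w)%:E).
  exact/measurable_EFinP/measurable_funPT.
have meq (f : Omega -> \bar R) z :
    measurable_fun setT f -> measurable [set w | f w = z].
  by move=> mf; rewrite -[mkset _]setTI; exact: (mf measurableT [set z]).
have msup : measurable_fun setT (fun w => limn_esup (fun n => (X (A_ n) w)%:E)).
  exact: measurable_fun_limn_esup.
have minf : measurable_fun setT (fun w => limn_einf (fun n => (X (A_ n) w)%:E)).
  rewrite /limn_einf; apply: measurableT_comp => //.
  apply: measurable_fun_limn_esup => n.
  exact: measurableT_comp.
split; last split.
(* Countably many slopes [q.+1%:R^-1] yield a single null set for all [e > 0]. *)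
- have ge : {ae P, forall w (q : nat), exists n0, forall n, (n0 <= n)%N ->
      - (q.+1%:R^-1 * v n) <= D 0 n w}.
    apply: ae_foralln => q; exact: walk_ge_eventually.
  apply: filterS2 lo ge => w lo_w ge_w.
  (* Early variances may vanish; from [n0] on the quotient is a genuine one. *)
  have [n0 vn0] := vy 0.
  have vgt0 n : (n0 <= n)%N -> 0 < v n.+1.
    by move=> n0n; rewrite (lt_le_trans vn0)// ndv// ltnW.
  apply: limn_einf_eq0 => [N|e e0].
    have [n Nn Dn] := shift (fun x => x <= - 0%:R) w (lo_w 0) (maxn n0 N).
    move: Nn; rewrite geq_max => /andP[/vgt0 vn Nn]; exists n => //.
    rewrite -[fine _]/(v n.+1) mulr_le0_ge0 ?invr_ge0 ?(ltW vn)//.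
    by rewrite (le_trans Dn)// oppr0.
  have [q qe] : exists q : nat, q.+1%:R^-1 < e.
    exists (Num.bound e^-1); rewrite invf_plt ?posrE ?ltr0n//.
    by rewrite (lt_le_trans (archi_boundP _)) ?invr_ge0 ?(ltW e0)// ler_nat.
  have [n1 hn1] := ge_w q.
  exists (maxn n0 n1) => // n /=; rewrite geq_max => /andP[n0n n1n].
  have vn := vgt0 n n0n; rewrite -[fine _]/(v n.+1) ler_pdivlMr// mulNr XD.
  apply: le_trans _ (hn1 n.+1 (leqW n1n)).
  by rewrite lerN2 ler_wpM2r// ltW.
- apply: prob1; first exact: meq.
  apply: filterS lo => w lo_w; apply: limn_einf_Ny => M.
  exact: (shift (fun x => x <= - M%:R) w (lo_w M)).
- apply: prob1; first exact: meq.
  apply: filterS hi => w hi_w.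
  (* The upper limit is the opposite of the lower limit of the opposite sequence. *)
  apply: oppe_inj; rewrite -limn_einfN /=; apply: limn_einf_Ny => M N.
  have [n Nn Dn] := shift (fun x => M%:R <= x) w (hi_w M) N.
  by exists n => //; rewrite lerN2.
Qed.
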